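(* Every finite-dimensional weakly systolic simplicial complex is contractible.
   Context: Conventions: a complex $X$ is assumed connected and non-empty; simplices are finite. For vertices $v,w$ of $X$ write $v\sim w$ if they span an edge. $d$ denotes the path metric of the $1$-skeleton on the vertex set. $X$ is flag if every finite set of pairwise adjacent vertices spans a simplex. For a simplex $\sigma$, the link $X_\sigma$ is the subcomplex of simplices $\tau$ with $\tau\cap\sigma=\emptyset$ such that $\tau\cup\sigma$ spans a simplex of $X$. For a subcomplex $A$, $B_i(A)$ (resp. $S_i(A)$) is the full subcomplex spanned by the vertices at distance at most $i$ (resp. exactly $i$) from the vertex set of $A$. Property $\widetilde{SD}_n(A)$ of a flag complex $X$: for every $i=1,\dots,n$, (E) for every edge $e\in S_{i+1}(A)$ the intersection $X_e\cap B_i(A)$ is non-empty; (V) for every vertex $w\in S_{i+1}(A)$ the intersection $X_w\cap B_i(A)$ is a single simplex. $X$ is weakly systolic if it is flag and satisfies $\widetilde{SD}_n(v)$ for every $n\in\mathbb N$ and every vertex $v$ of $X$. *)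

(* Defs.v *)
From HB Require Import structures.
From mathcomp Require Import all_boot all_order all_algebra finmap.
From mathcomp Require Import all_classical all_reals all_analysis.
Import Order.TTheory GRing.Theory Num.Theory numFieldNormedType.Exports.

Set Implicit Arguments.
Unset Strict Implicit.
Unset Printing Implicit Defensive.

Local Open Scope classical_set_scope.
Local Open Scope fset_scope.
Local Open Scope nat_scope.

(* Simplices are the non-empty ones.  The vertices of a complex over V are the
   v with [fset v] a simplex: they need not exhaust V, so that subcomplexes of
   X are complexes over the same V. *)
Record complex (V : choiceType) := Complex {
  simplex : set {fset V};
  simplex_neq0 : forall s, simplex s -> s != fset0;
  simplex_sub : forall s t, simplex s -> t `<=` s -> t != fset0 -> simplex t }.

Definition vertex (V : choiceType) (X : complex V) : set V :=
  [set v | simplex X [fset v]].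

Definition adj (V : choiceType) (X : complex V) (v w : V) : Prop :=
  v != w /\ simplex X [fset v; w].

Definition walk (V : choiceType) (X : complex V) (n : nat) (v w : V) : Prop :=
  exists p : nat -> V,
    [/\ p 0 = v, p n = w & forall i, i < n -> adj X (p i) (p i.+1)].

Definition nonempty_complex (V : choiceType) (X : complex V) : Prop :=
  vertex X !=set0.

Definition connected_complex (V : choiceType) (X : complex V) : Prop :=
  forall v w, vertex X v -> vertex X w -> exists n, walk X n v w.

Definition finite_dimensional (V : choiceType) (X : complex V) : Prop :=
  exists d, forall s, simplex X s -> #|` s| <= d.+1.

Definition flag (V : choiceType) (X : complex V) : Prop :=
  forall s : {fset V}, s != fset0 ->
    (forall v, v \in s -> vertex X v) ->
    (forall v w, v \in s -> w \in s -> v != w -> adj X v w) ->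
    simplex X s.

(* The least element of P, by convention 0 if P is empty: dist and dist_to below
   are meaningful for X connected and A non-empty. *)
Definition nat_inf (P : set nat) : nat :=
  xget 0 [set n | P n /\ forall m, P m -> n <= m].

Definition dist (V : choiceType) (X : complex V) (v w : V) : nat :=
  nat_inf [set n | walk X n v w].

Definition dist_to (V : choiceType) (X A : complex V) (w : V) : nat :=
  nat_inf [set dist X a w | a in vertex A].

Lemma full_neq0 (V : choiceType) (X : complex V) (W : set V) (s : {fset V}) :
  (simplex X s /\ forall v, v \in s -> W v) -> s != fset0.
Proof. by case=> /simplex_neq0. Qed.

Lemma full_sub (V : choiceType) (X : complex V) (W : set V) (s t : {fset V}) :
  (simplex X s /\ forall v, v \in s -> W v) -> t `<=` s -> t != fset0 ->
  simplex X t /\ forall v, v \in t -> W v.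
Proof.
case=> Xs sW ts t0; split; first exact: simplex_sub Xs ts t0.
by move=> v /(fsubsetP ts); exact: sW.
Qed.

Definition full (V : choiceType) (X : complex V) (W : set V) : complex V :=
  @Complex V [set s | simplex X s /\ forall v, v \in s -> W v]
    (@full_neq0 V X W) (@full_sub V X W).

Definition ball_complex (V : choiceType) (X : complex V) (i : nat)
    (A : complex V) : complex V :=
  full X [set w | dist_to X A w <= i].

Definition sphere_complex (V : choiceType) (X : complex V) (i : nat)
    (A : complex V) : complex V :=
  full X [set w | dist_to X A w = i].

Lemma link_neq0 (V : choiceType) (X : complex V) (s t : {fset V}) :
  [/\ t != fset0, t `&` s = fset0 & simplex X (t `|` s)] -> t != fset0.
Proof. by case. Qed.

Lemma link_sub (V : choiceType) (X : complex V) (s t u : {fset V}) :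
  [/\ t != fset0, t `&` s = fset0 & simplex X (t `|` s)] ->
  u `<=` t -> u != fset0 ->
  [/\ u != fset0, u `&` s = fset0 & simplex X (u `|` s)].
Proof.
case=> _ ts Xts ut u0; split=> //.
  by apply/eqP; rewrite -fsubset0 -ts fsetSI.
apply: (simplex_sub Xts); first exact: fsetSU.
by apply: contra u0 => /eqP us0; rewrite -fsubset0 -us0 fsubsetUl.
Qed.

Definition link (V : choiceType) (X : complex V) (s : {fset V}) : complex V :=
  @Complex V
    [set t | [/\ t != fset0, t `&` s = fset0 & simplex X (t `|` s)]]
    (@link_neq0 V X s) (@link_sub V X s).

Lemma cap_neq0 (V : choiceType) (X Y : complex V) (s : {fset V}) :
  simplex X s /\ simplex Y s -> s != fset0.
Proof. by case=> /simplex_neq0. Qed.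

Lemma cap_sub (V : choiceType) (X Y : complex V) (s t : {fset V}) :
  simplex X s /\ simplex Y s -> t `<=` s -> t != fset0 ->
  simplex X t /\ simplex Y t.
Proof.
by case=> Xs Ys ts t0; split; [exact: simplex_sub Xs ts t0|
                               exact: simplex_sub Ys ts t0].
Qed.

Definition cap (V : choiceType) (X Y : complex V) : complex V :=
  @Complex V [set s | simplex X s /\ simplex Y s]
    (@cap_neq0 V X Y) (@cap_sub V X Y).

(* K consists of one (non-empty) simplex t together with all its faces. *)
Definition single_simplex (V : choiceType) (K : complex V) : Prop :=
  exists2 t : {fset V}, t != fset0 &
    forall s, simplex K s <-> s != fset0 /\ s `<=` t.

Definition SD (V : choiceType) (X : complex V) (n : nat) (A : complex V) :
    Prop :=
  forall i, 1 <= i <= n ->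
    (forall e, simplex (sphere_complex X i.+1 A) e -> #|` e| = 2 ->
       nonempty_complex (cap (link X e) (ball_complex X i A))) /\
    (forall w, vertex (sphere_complex X i.+1 A) w ->
       single_simplex (cap (link X [fset w]) (ball_complex X i A))).

Definition weakly_systolic (V : choiceType) (X : complex V) : Prop :=
  flag X /\
  forall n v, vertex X v -> SD X n (full X [set v]).

Local Open Scope ring_scope.

Definition std_simplex (R : realType) (V : choiceType) (s : {fset V}) :
    set (V -> R) :=
  [set x | [/\ forall v, 0 <= x v,
               forall v, v \notin s -> x v = 0 &
               \sum_(v <- s) x v = 1]].

(* A point of |X| is given by its barycentric coordinates. *)
Record realization (R : realType) (V : choiceType) (X : complex V) :=
  Realization {
    coord :> V -> R;
    coordP : exists2 s, simplex X s & std_simplex s coord }.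

HB.instance Definition _ (R : realType) (V : choiceType) (X : complex V) :=
  gen_eqMixin (realization R X).
HB.instance Definition _ (R : realType) (V : choiceType) (X : complex V) :=
  gen_choiceMixin (realization R X).

(* Weak (CW) topology: U is open iff its trace on each closed simplex is open
   for the Euclidean topology, given there by the sup distance between the
   finitely many barycentric coordinates.  (X may fail to be locally finite,
   in which case this topology is not metrizable.) *)
Definition realization_open (R : realType) (V : choiceType) (X : complex V)
    (U : set (realization R X)) : Prop :=
  forall s, simplex X s -> forall x : realization R X,
    std_simplex s x -> U x ->
    exists2 e : R, 0 < e &
      forall y : realization R X, std_simplex s y ->
        (forall v, v \in s -> `|x v - y v| < e) -> U y.

Lemma realization_openT (R : realType) (V : choiceType) (X : complex V) :
  realization_open [set: realization R X].
Proof. by move=> s _ x _ _; exists 1. Qed.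

Lemma realization_openI (R : realType) (V : choiceType) (X : complex V) :
  setI_closed (@realization_open R V X).
Proof.
move=> A B oA oB s Xs x sx [Ax Bx].
have [e e0 eA] := oA s Xs x sx Ax; have [f f0 fB] := oB s Xs x sx Bx.
exists (Num.min e f); first by rewrite lt_min e0.
move=> y sy xy; split.
  by apply: eA => // v /xy; rewrite lt_min => /andP[].
by apply: fB => // v /xy; rewrite lt_min => /andP[].
Qed.

Lemma realization_open_bigU (R : realType) (V : choiceType) (X : complex V)
    (I : Type) (f : I -> set (realization R X)) :
  (forall i, realization_open (f i)) -> realization_open (\bigcup_i f i)%classic.
Proof.
move=> of_ s Xs x sx [i _ fix_]; have [e e0 ef] := of_ i s Xs x sx fix_.
by exists e => // y sy xy; exists i => //; exact: ef.
Qed.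

HB.instance Definition _ (R : realType) (V : choiceType) (X : complex V) :=
  isOpenTopological.Build (realization R X)
    (@realization_openT R V X) (@realization_openI R V X)
    (@realization_open_bigU R V X).

Definition contractible (R : realType) (T : topologicalType) : Prop :=
  exists (x0 : T) (H : T * R -> T),
    [/\ {within ([set: T] `*` `[0, 1])%classic, continuous H},
        forall x, H (x, 0) = x & forall x, H (x, 1) = x0].

(* Main.v *)
Require Import Defs.
From mathcomp Require Import all_boot all_order all_algebra finmap.
From mathcomp Require Import all_classical all_reals all_analysis.
From mathcomp Require Import ring lra.
Import Order.TTheory GRing.Theory Num.Theory numFieldNormedType.Exports.

(** Fix a base vertex [v0] and collapse the balls around it, each onto the next
smaller one.

The combinatorial input is that a clique contained in the sphere of radius
[k + 1] has a common neighbour in the ball of radius [k] ([lower_common_nbr]), and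
that two vertices of that ball with a common neighbour in the sphere are equal
or adjacent ([lower_nbrs_adj]). The first fact is conditions (E) and (V) for
cliques of one or two vertices at distance 2 or more, while at distance 1 the
base vertex serves; larger cliques follow by induction, because a
weakly systolic complex has no 4-cycle without diagonals ([no_induced_square]).

A point [x] of the ball of radius [k + 1] is a convex combination of vertices,
and its weights on the sphere define superlevel sets [{w | r < x w}], which are
cliques decreasing with [r]. The collapse up to level [c] truncates the weights
on the sphere to [x w - c] and gives the removed mass to common neighbours:
every level [r < c] sends the mass of its superlevel set to one chosen common
neighbour of that set, the apex. All vertices involved span a simplex
([collapse_point]), since two nested superlevel sets share a vertex, which is
adjacent to both apexes. Nothing happens for [c <= 0], and for [1 <= c] no mass
remains on the sphere. The weight of an apex is the integral over [r] of a step
function; as the weights vary it is computed by minima and maxima only, so it is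
a Lipschitz function of [x] and [c] once the support of [x] is confined to a given
finite set ([layer_int_lip]).

The collapses of all radii are concatenated, that of radius [k + 1] being
performed while [t] runs from [2 ^ - (k + 1)] to [2 ^ - k]. A point of the ball
of radius [n] does not move before time [2 ^ - n], so over a given simplex only
finitely many collapses matter ([deform_stable]), and at time [1] everything has
reached [v0]. The result is Lipschitz over every finite set of vertices, and such
a map is continuous on the product of the realization with the line, by a tube
lemma argument on each simplex ([fin_lipschitz_continuous]). *)

Set Implicit Arguments.
Unset Strict Implicit.
Unset Printing Implicit Defensive.

Local Open Scope classical_set_scope.
Local Open Scope fset_scope.
Local Open Scope nat_scope.

(** * Distances and cliques *)

Lemma nat_infP (P : set nat) n : P n -> P (nat_inf P) /\ nat_inf P <= n.
Proof.
move=> Pn; rewrite /nat_inf.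
have [m Pm mmin] : exists2 m, P m & forall k, P k -> m <= k.
  have exP : exists m, `[< P m >] by exists n; apply/asboolP.
  case: (ex_minnP exP) => m /asboolP Pm mmin; exists m => // k Pk.
  by apply: mmin; apply/asboolP.
case: xgetP => [k _ [Pk kmin]|/(_ m)/not_andP[]//]; by split=> //; exact: kmin.
Qed.

Lemma adj_sym (V : choiceType) (X : complex V) v w : adj X v w -> adj X w v.
Proof. by case=> vw Xvw; split; [rewrite eq_sym|rewrite fsetUC]. Qed.

Lemma adj_vertex (V : choiceType) (X : complex V) v w : adj X v w -> vertex X v.
Proof.
case=> _ /simplex_sub; apply; first by rewrite fsub1set fset21.
by rewrite -cardfs_eq0 cardfs1.
Qed.

Lemma simplex_adj (V : choiceType) (X : complex V) s v w :
  simplex X s -> v \in s -> w \in s -> v != w -> adj X v w.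
Proof.
move=> Xs vs ws vw; split=> //; apply: simplex_sub Xs _ _.
  by rewrite fsubUset !fsub1set vs.
by apply/fset0Pn; exists v; rewrite fset21.
Qed.

Lemma simplex_vertex (V : choiceType) (X : complex V) s v :
  simplex X s -> v \in s -> vertex X v.
Proof.
move=> Xs vs; apply: simplex_sub Xs _ _; first by rewrite fsub1set.
by rewrite -cardfs_eq0 cardfs1.
Qed.

Lemma walkS (V : choiceType) (X : complex V) n u v w :
  walk X n u v -> adj X v w -> walk X n.+1 u w.
Proof.
case=> p [p0 pn padj] vw; exists (fun i => if i <= n then p i else w).
split=> [|| i]; rewrite ?ltnn // ltnS => ilen; rewrite ilen.
by move: ilen; rewrite leq_eqVlt => /orP[/eqP ->|iln]; rewrite ?ltnn ?pn// iln;
  exact: padj.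
Qed.

Lemma walk0 (V : choiceType) (X : complex V) v w : walk X 0 v w -> v = w.
Proof. by case=> p [<- <-]. Qed.

Lemma walk1 (V : choiceType) (X : complex V) v w : walk X 1 v w -> adj X v w.
Proof. by case=> p [<- <-]; exact. Qed.

Lemma walk_refl (V : choiceType) (X : complex V) v : walk X 0 v v.
Proof. by exists (fun=> v). Qed.

Lemma dist_walk (V : choiceType) (X : complex V) n v w :
  walk X n v w -> walk X (dist X v w) v w /\ dist X v w <= n.
Proof. exact: (@nat_infP [set n | walk X n v w]). Qed.

Lemma dist_refl (V : choiceType) (X : complex V) v : dist X v v = 0.
Proof. by have [_] := dist_walk (walk_refl X v); case: dist. Qed.

Lemma dist_to_vertex (V : choiceType) (X : complex V) v w : vertex X v ->
  dist_to X (full X [set v]) w = dist X v w.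
Proof.
move=> Xv; rewrite /dist_to.
have -> : [set dist X a w | a in vertex (full X [set v])] = [set dist X v w].
  apply/seteqP; split=> [_ [a [_ av] <-]|_ ->].
    by rewrite /= (av a (fset11 a)).
  by exists v => //; split=> // u; rewrite in_fset1 => /eqP ->.
by have [] := @nat_infP [set dist X v w] _ (erefl _).
Qed.

(** * Projections of cliques towards a base vertex *)

Lemma cap_link_ball (V : choiceType) (X : complex V) v i e u :
  vertex X v -> e != fset0 ->
  simplex (cap (link X e) (ball_complex X i (full X [set v]))) [fset u] <->
  [/\ u \notin e, simplex X (u |` e) & dist X v u <= i].
Proof.
move=> Xv e0; split.
  case=> -[_ ue Xue] [_ /(_ u (fset11 u))]; rewrite /= dist_to_vertex// => ui.
  split=> //; apply/negP => ue'; have : u \in [fset u] `&` e.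
    by rewrite in_fsetI fset11.
  by rewrite ue in_fset0.
case=> ue Xue ui; split; split=> //.
- by apply/fset0Pn; exists u; rewrite fset11.
- apply/fsetP => z; rewrite in_fsetI in_fset1 in_fset0.
  by apply/negbTE; apply: contra ue => /andP[/eqP <-].
- by apply: (simplex_vertex Xue); rewrite fset1U1.
- by move=> z; rewrite in_fset1 => /eqP ->; rewrite /= dist_to_vertex.
Qed.

(** From distance 2 on, this is the condition (V) on vertices: the lower neighbours of
[w] lie in one simplex. At distance 1 the base vertex is the only lower vertex. *)
Lemma lower_nbrs_adj (V : choiceType) (X : complex V) v i w u u' :
  connected_complex X -> weakly_systolic X -> vertex X v ->
  dist X v w = i.+1 -> adj X u w -> adj X u' w ->
  dist X v u <= i -> dist X v u' <= i -> u = u' \/ adj X u u'.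
Proof.
move=> Xc [Xf XS] Xv wi uw u'w.
case: i wi => [w1|i wi].
  have e0 z : adj X z w -> dist X v z <= 0 -> v = z.
    move=> /adj_vertex Xz; have [n nvz] := Xc _ _ Xv Xz.
    by have [+ _] := dist_walk nvz; case: (dist X v z) => // /walk0.
  by move=> /(e0 _ uw) <- /(e0 _ u'w) <-; left.
move=> ui u'i.
have [|_ /(_ w)[]] := XS i.+1 v Xv i.+1; first by rewrite ltnS leqnn.
  split; first exact: adj_vertex (adj_sym uw).
  by move=> z; rewrite in_fset1 => /eqP ->; rewrite /= dist_to_vertex.
move=> t t0 tP.
have inT z : adj X z w -> dist X v z <= i.+1 -> z \in t.
  move=> [zw Xzw] zi; rewrite -fsub1set.
  suff /tP[] : simplex (cap (link X [fset w])
    (ball_complex X i.+1 (full X [set v]))) [fset z] by [].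
  apply/cap_link_ball => //; last by rewrite in_fset1.
  by rewrite -cardfs_eq0 cardfs1.
have /tP[[_ _ Xtw] _] : t != fset0 /\ t `<=` t by [].
have [->|uu'] := eqVneq u u'; [by left|right].
by apply: (simplex_adj Xtw); rewrite // in_fsetU inT.
Qed.

(** Seen from [a], the opposite vertex of a 4-cycle without diagonals would be at
distance 2, and its two neighbours on the cycle would be lower neighbours. *)
Lemma no_induced_square (V : choiceType) (X : complex V) a b c d :
  connected_complex X -> weakly_systolic X ->
  adj X a b -> adj X b c -> adj X c d -> adj X d a ->
  [\/ a = c, adj X a c, b = d | adj X b d].
Proof.
move=> Xc Xw ab bc cd da.
have [->|ac] := eqVneq a c; first by constructor 1.
have [?|nac] := pselect (adj X a c); first by constructor 2.
have ac2 : dist X a c = 2.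
  have [] := dist_walk (walkS (walkS (walk_refl X a) ab) bc).
  case: (dist X a c) => [/walk0/eqP|[/walk1//|[//|//]]].
  by rewrite (negbTE ac).
have d1 z : adj X a z -> dist X a z <= 1.
  by move=> az; have [] := dist_walk (walkS (walk_refl X a) az).
have [||->|] := lower_nbrs_adj Xc Xw (adj_vertex ab) ac2 bc (adj_sym cd).
- exact: d1.
- exact/d1/adj_sym.
- by constructor 3.
- by constructor 4.
Qed.

(** At distance 1 the base vertex serves. From distance 2 on, cliques of one or two
vertices are the conditions (V) and (E), and larger ones follow by induction: if [x] is adjacent to all vertices but [w1] and [y] to all but [w2],
then [x] and [y] are lower neighbours of a third vertex, hence equal or adjacent,
and a diagonal of the square [w1], [w2], [x], [y] makes one of them adjacent to
the whole clique. *)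
Lemma lower_common_nbr (V : choiceType) (X : complex V) v i (s : {fset V}) :
  connected_complex X -> weakly_systolic X -> vertex X v ->
  simplex X s -> (forall w, w \in s -> dist X v w = i.+1) ->
  exists u, [/\ vertex X u, dist X v u <= i & forall w, w \in s -> adj X u w].
Proof.
move=> Xc Xw Xv; case: i => [Xs s1|i].
  exists v; split=> //; first by rewrite dist_refl.
  move=> w ws; apply: walk1; rewrite -(s1 _ ws).
  have [n vw] := Xc _ _ Xv (simplex_vertex Xs ws).
  by have [] := dist_walk vw.
have ile : 1 <= i.+1 <= i.+1 by rewrite leqnn.
move En : #|` s| => n; elim: n s En => [|n IHn] s En Xs si.
  by have := simplex_neq0 Xs; rewrite -cardfs_eq0 En.
have /fset0Pn[w1 w1s] := simplex_neq0 Xs.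
have En1 : #|` s `\ w1| = n by move: En; rewrite (cardfsD1 w1) w1s => -[].
have Xs1 := simplex_vertex Xs w1s.
have [E0|s1n0] := eqVneq (s `\ w1) fset0.
  have [_ /(_ w1)[]] := Xw.2 i.+1 v Xv i.+1 ile.
    by split=> // z; rewrite in_fset1 => /eqP ->; rewrite /= dist_to_vertex// si.
  move=> t /fset0Pn[u ut] /(_ [fset u])[_].
  rewrite fsub1set ut -cardfs_eq0 cardfs1 => /(_ (conj isT isT)).
  have w10 : [fset w1] != fset0 by rewrite -cardfs_eq0 cardfs1.
  move=> /(cap_link_ball _ _ Xv w10)[]; rewrite in_fset1 => uw1 Xuw ui.
  exists u; split=> //; first by apply: (simplex_vertex Xuw); rewrite fset1U1.
  move=> w ws; suff -> : w = w1 by [].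
  apply/eqP/negbNE/negP => ww1; have : w \in s `\ w1 by rewrite !inE ww1.
  by rewrite E0.
have /fset0Pn[w2] := s1n0; rewrite !inE => /andP[w21 w2s].
have En2 : #|` s `\ w2| = n by move: En; rewrite (cardfsD1 w2) w2s => -[].
have [E0|] := eqVneq (s `\ w1 `\ w2) fset0.
  have [+ _] := Xw.2 i.+1 v Xv i.+1 ile.
  have Es : s = [fset w1; w2].
    apply/fsetP => z; move/fsetP/(_ z): E0; rewrite !inE.
    by do 2![case: eqVneq => [-> //|_] /=]; rewrite ?w1s ?w2s ?orbT//= => ->.
  case/(_ s); [split=> // w ws; rewrite /= dist_to_vertex// si //| |].
    by rewrite Es cardfs2 eq_sym w21.
  move=> u /(cap_link_ball _ _ Xv (simplex_neq0 Xs))[us Xus ui].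
  exists u; split=> //; first by apply: (simplex_vertex Xus); rewrite fset1U1.
  move=> w ws; apply: (simplex_adj Xus); rewrite ?fset1U1 ?inE ?ws ?orbT//.
  by apply: contraNneq us => ->.
move=> /fset0Pn[w3]; rewrite !inE => /and3P[w32 w31 w3s].
have X1 : simplex X (s `\ w1).
  by apply: simplex_sub Xs _ s1n0; exact: fsubD1set.
have X2 : simplex X (s `\ w2).
  apply: simplex_sub Xs _ _; first exact: fsubD1set.
  by apply/fset0Pn; exists w1; rewrite !inE eq_sym w21.
have lvl z w : w \in s `\ z -> dist X v w = i.+2.
  by rewrite !inE => /andP[_]; exact: si.
have [x [Xx xi xs]] := IHn _ En1 X1 (lvl w1).
have [y [Xy yi ys]] := IHn _ En2 X2 (lvl w2).
have w12 : adj X w1 w2 by apply: (simplex_adj Xs) => //; rewrite eq_sym.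
have xw z : z \in s -> z != w1 -> adj X x z by move=> zs z1; apply: xs; rewrite !inE z1.
have yw z : z \in s -> z != w2 -> adj X y z by move=> zs z1; apply: ys; rewrite !inE z1.
have [||exy|xy] := lower_nbrs_adj Xc Xw Xv (si _ w3s) (xw _ w3s w31) (yw _ w3s w32) => //.
  exists y; split=> // w ws; have [->|ww2] := eqVneq w w2; last exact: yw.
  by rewrite -exy; exact: xw.
have w12' : w1 != w2 by rewrite eq_sym.
case: (no_induced_square Xc Xw w12 (adj_sym (xw _ w2s w21)) xy (yw _ w1s w12'))
  => [xw1|xw1|yw2|yw2].
- by move: xi; rewrite -xw1 si// ltnn.
- exists x; split=> // w ws; have [->|] := eqVneq w w1; last exact: xw.
  exact: adj_sym.
- by move: yi; rewrite -yw2 si// ltnn.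
- exists y; split=> // w ws; have [->|] := eqVneq w w2; last exact: yw.
  exact: adj_sym.
Qed.

(** * Integrals over superlevel sets *)

Local Open Scope ring_scope.

(** The integral over [r] from [lo] to [hi] of [g] at the union of [s] with the superlevel
set [{w in W | r < x w}]: a point [a] belongs to that set exactly for [r < x a], so
the interval is cut at [x a]. As [W] is finite the integrand is a step function,
and this form uses minima and maxima only. *)
Fixpoint layer_int (R : realFieldType) (V : choiceType) (g : {fset V} -> R)
    (x : V -> R) (W : seq V) (s : {fset V}) (lo hi : R) : R :=
  if W is a :: W' then
    layer_int g x W' (a |` s) lo (Num.min hi (x a)) +
    layer_int g x W' s (Num.max lo (x a)) hi
  else Num.max 0 (hi - lo) * g s.

Lemma dist_min (R : realFieldType) (a b a' b' d : R) :
  `|a - a'| <= d -> `|b - b'| <= d -> `|Num.min a b - Num.min a' b'| <= d.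
Proof.
rewrite !ler_norml => ? ?.
by case: (leP a b) => ?; case: (leP a' b') => ?; lra.
Qed.

Lemma dist_max (R : realFieldType) (a b a' b' d : R) :
  `|a - a'| <= d -> `|b - b'| <= d -> `|Num.max a b - Num.max a' b'| <= d.
Proof.
rewrite !ler_norml => ? ?.
by case: (leP a b) => ?; case: (leP a' b') => ?; lra.
Qed.

Section LayerInt.
Variables (R : realFieldType) (V : choiceType).
Implicit Types (g : {fset V} -> R) (x y : V -> R) (W : seq V) (s : {fset V}).

Lemma layer_int_catC g x W1 W2 W3 s lo hi :
  layer_int g x (W1 ++ W2 ++ W3) s lo hi = layer_int g x (W2 ++ W1 ++ W3) s lo hi.
Proof.
have swap a b W s' l h :
    layer_int g x [:: a, b & W] s' l h = layer_int g x [:: b, a & W] s' l h.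
  rewrite /= fsetUCA (minAC h) (maxAC l) -!addrA; congr (_ + _).
  by rewrite addrCA.
have cons2 a W W' : (forall s l h, layer_int g x W s l h = layer_int g x W' s l h) ->
    forall s l h, layer_int g x (a :: W) s l h = layer_int g x (a :: W') s l h.
  by move=> E s' l h; rewrite /= !E.
elim: W2 s lo hi => [|b W2 IH] s lo hi //.
rewrite [RHS]/= -!IH -[RHS]/(layer_int g x (b :: W1 ++ W2 ++ W3) s lo hi).
rewrite cat_cons; move: (W2 ++ W3) => {IH W2 W3} W.
elim: W1 s lo hi => [|a W1 IH] s lo hi //.
rewrite !cat_cons swap; exact: cons2.
Qed.

Lemma layer_int_perm g x W W' : perm_eq W W' ->
  forall s lo hi, layer_int g x W s lo hi = layer_int g x W' s lo hi.
Proof.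
move=> WW' s lo hi; rewrite perm_sym in WW'.
pattern W; apply: (catCA_perm_ind _ WW') => // W1 W2 W3 <-.
exact: layer_int_catC.
Qed.

Lemma layer_int_empty g x W s lo hi : hi <= lo -> layer_int g x W s lo hi = 0.
Proof.
elim: W s lo hi => [|a W IH] s lo hi /= hilo.
  by rewrite max_l ?mul0r// subr_le0.
rewrite !IH ?addr0//; first by rewrite le_max hilo.
by rewrite ge_min hilo.
Qed.

Lemma layer_int_drop g x W1 W2 s lo hi : (forall a, a \in W1 -> x a <= lo) ->
  layer_int g x (W1 ++ W2) s lo hi = layer_int g x W2 s lo hi.
Proof.
elim: W1 => [//|a W1 IH] W1lo; have alo := W1lo a (mem_head _ _).
rewrite /= layer_int_empty ?ge_min ?alo ?orbT// add0r max_l// IH//.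
by move=> b bW1; apply: W1lo; rewrite inE bW1 orbT.
Qed.

(** The integral over levels above [lo] is unaffected by points whose value is at most
[lo]: they lie in no superlevel set. *)
Lemma layer_int_widen g x W W' s lo hi : uniq W -> uniq W' -> {subset W <= W'} ->
  (forall a, a \in W' -> a \notin W -> x a <= lo) ->
  layer_int g x W' s lo hi = layer_int g x W s lo hi.
Proof.
move=> uW uW' sW W'lo.
rewrite (@layer_int_perm _ _ _ ([seq a <- W' | a \notin W] ++ W)).
  by apply: layer_int_drop => a; rewrite mem_filter => /andP[/[swap]]; exact: W'lo.
have /perm_trans -> // : perm_eq W'
    ([seq a <- W' | a \notin W] ++ [seq a <- W' | a \in W]).
  by rewrite -(perm_filterC (mem W) W') perm_catC.
rewrite perm_cat2l; apply: uniq_perm; rewrite ?filter_uniq// => a.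
by rewrite mem_filter; case: (boolP (a \in W)) => // /sW ->.
Qed.

Lemma layer_int_ext g g' x W s lo hi :
  (forall t, {subset t <= (s : seq V) ++ W} -> g t = g' t) ->
  layer_int g x W s lo hi = layer_int g' x W s lo hi.
Proof.
elim: W s lo hi => [|a W IH] s lo hi gg' /=.
  by rewrite gg'// => w; rewrite mem_cat => ->.
rewrite !IH// => t tW; apply: gg' => w /tW; rewrite !mem_cat ?inE.
  by case/orP => ->; rewrite ?orbT.
by rewrite -orbA orbCA orbA.
Qed.

Lemma layer_int_ge0 g x W s lo hi : (forall t, 0 <= g t) ->
  0 <= layer_int g x W s lo hi.
Proof.
move=> g0; elim: W s lo hi => [|a W IH] s lo hi /=; last by rewrite addr_ge0.
by rewrite mulr_ge0// le_max lexx.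
Qed.

(** A step function with nonzero integral has a nonzero value: some level [r] has a
superlevel set [t] with [g t != 0]. *)
Lemma layer_int_neq0 g x W s lo hi : layer_int g x W s lo hi != 0 ->
  exists r t, [/\ lo <= r, r < hi, g t != 0 &
    forall w, w \in t = (w \in s) || (w \in W) && (r < x w)].
Proof.
elim: W s lo hi => [|a W IH] s lo hi /=.
  rewrite mulf_eq0 negb_or => /andP[h gs]; exists lo, s; split=> //.
    rewrite -subr_gt0 lt_neqAle eq_sym.
    by move: h; case: (ltP 0 (hi - lo)) => [? ->|_]; [exact: ltW|rewrite eqxx].
  by move=> w; rewrite orbF.
have [->|/IH[r [t [lor rhi gt tP]]] _] :=
    eqVneq (layer_int g x W (a |` s) lo (Num.min hi (x a))) 0.
  rewrite add0r => /IH[r [t [lor rhi gt tP]]].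
  move: lor; rewrite ge_max => /andP[lor ar]; exists r, t; split=> // w.
  rewrite tP in_cons; have [->|//] := eqVneq w a.
  by rewrite [r < _]ltNge ar !andbF.
move: rhi; rewrite lt_min => /andP[rhi ra]; exists r, t; split=> // w.
rewrite tP in_fset1U in_cons; have [->/=|//] := eqVneq w a.
by rewrite ra orbT.
Qed.

Lemma layer_int_sum (U : seq V) (g : V -> {fset V} -> R) x W s lo hi :
  \sum_(u <- U) layer_int (g u) x W s lo hi =
  layer_int (fun t => \sum_(u <- U) g u t) x W s lo hi.
Proof.
elim: W s lo hi => [|a W IH] s lo hi /=; first by rewrite mulr_sumr.
by rewrite big_split /= !IH.
Qed.

(** Exchanging sum and integral, a point [w] of [W] contributes the length of the set of
levels below [x w]. *)
Lemma layer_int_card x W s lo hi : uniq W -> (forall w, w \in W -> w \notin s) ->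
  layer_int (fun t => #|` t|%:R) x W s lo hi =
  #|` s|%:R * Num.max 0 (hi - lo) +
  \sum_(w <- W) Num.max 0 (Num.min hi (x w) - lo).
Proof.
elim: W s lo hi => [|a W IH] s lo hi /=; first by rewrite big_nil addr0 mulrC.
case/andP=> aW uW Ws.
have as_ := Ws a (mem_head _ _).
have Ws' w : w \in W -> w \notin s by move=> wW; apply: Ws; rewrite inE wW orbT.
have split_pos l h b : Num.max 0 (Num.min h b - l) + Num.max 0 (h - Num.max l b) =
    Num.max 0 (h - l) :> R.
  by case: (leP h b) => ?; case: (leP l b) => ?; do ![case: leP => ?]; lra.
rewrite !IH//; last first.
  move=> w wW; rewrite in_fset1U negb_or Ws'// andbT.
  by apply: contraNneq aW => <-.
rewrite cardfsU1 as_ add1n -natr1 mulrDl mul1r big_cons.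
rewrite -(split_pos lo hi (x a)) mulrDr.
under [in RHS]eq_bigr => w _ do rewrite -(split_pos _ _ (x a)).
rewrite big_split /=.
under eq_bigr => w _ do rewrite minAC.
by ring.
Qed.

(** The constant is uniform over all [g] bounded by [b], because only the endpoints of
the steps depend on [x]. *)
Lemma layer_int_lip (b : {fset V} -> R) W s : (forall t, 0 <= b t) ->
  exists2 L : R, 0 <= L & forall g x y lo lo' hi hi' (d : R), (forall t, `|g t| <= b t) ->
    (forall v, `|x v - y v| <= d) -> `|lo - lo'| <= d -> `|hi - hi'| <= d ->
    `|layer_int g x W s lo hi - layer_int g y W s lo' hi'| <= L * d.
Proof.
move=> b0; elim: W s => [|a W IH] s.
  exists (2 * b s); first by rewrite mulr_ge0.
  move=> g x y lo lo' hi hi' d gb xy ll hh /=.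
  rewrite -mulrBl normrM mulrAC ler_pM//.
  apply: dist_max; first by rewrite subrr normr0; have := normr_ge0 (lo - lo'); lra.
  by move: ll hh; rewrite !ler_norml; lra.
have [L1 L10 H1] := IH (a |` s); have [L2 L20 H2] := IH s.
exists (L1 + L2); first exact: addr_ge0.
move=> g x y lo lo' hi hi' d gb xy ll hh /=.
rewrite opprD addrACA mulrDl (le_trans (ler_normD _ _))// lerD//.
  by apply: H1 => //; exact: dist_min.
by apply: H2 => //; exact: dist_max.
Qed.

End LayerInt.

(** * Collapsing a ball onto the next smaller one *)

Definition is_point (R : realType) (V : choiceType) (X : complex V)
    (x : V -> R) : Prop :=
  exists2 s, simplex X s & std_simplex s x.

Definition supported (R : realType) (V : choiceType) (W : {fset V})
    (x : V -> R) : Prop :=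
  forall v, v \notin W -> x v = 0.

(** The support, provided that it is finite: [fset_set] of an infinite set is empty. *)
Definition fsupp (R : realType) (V : choiceType) (x : V -> R) : {fset V} :=
  fset_set [set v | x v != 0].

Section Points.
Variables (R : realType) (V : choiceType) (X : complex V).
Implicit Types (x : V -> R) (W : {fset V}).

Lemma in_fsupp W x v : supported W x -> (v \in fsupp x) = (x v != 0).
Proof.
move=> sx; rewrite in_fset_set; first by apply/idP/idP; rewrite inE.
apply: (sub_finite_set _ (finite_fset W)) => u /= xu.
by apply/negPn/negP => /sx/eqP; rewrite (negbTE xu).
Qed.

Lemma supported_fsupp W x : supported W x -> supported (fsupp x) x.
Proof. by move=> sx v; rewrite (in_fsupp _ sx) negbK => /eqP. Qed.

Lemma sum_supported W W' x : supported W x -> supported W' x ->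
  \sum_(v <- W) x v = \sum_(v <- W') x v.
Proof.
move=> sW sW'; rewrite (@big_fset_incl _ _ _ _ W (W `|` W')) ?fsubsetUl//;
  last by move=> v _ /sW.
by rewrite -(@big_fset_incl _ _ _ _ W' (W `|` W')) ?fsubsetUr// => v _ /sW'.
Qed.

Lemma is_point_ge0 x v : is_point X x -> 0 <= x v.
Proof. by case=> s _ [+ _ _]; exact. Qed.

Lemma is_point_supported x : is_point X x -> exists2 W, supported W x & simplex X W.
Proof. by case=> s Xs [_ sx _]; exists s. Qed.

Lemma is_point_sum W x : is_point X x -> supported W x -> \sum_(v <- W) x v = 1.
Proof. by case=> s _ [_ sx <-] sW; exact: sum_supported. Qed.

Lemma is_point_le1 x v : is_point X x -> x v <= 1.
Proof.
move=> px; have [W sW _] := is_point_supported px.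
have [vW|/sW -> //] := boolP (v \in W).
rewrite -(is_point_sum px sW) (big_fsetD1 v)//= lerDl.
by apply: sumr_ge0 => u _; exact: is_point_ge0.
Qed.

Lemma is_point_vertex x v : is_point X x -> x v != 0 -> vertex X v.
Proof.
case=> s Xs [_ sx _] xv; apply: (simplex_vertex Xs).
by apply: contraNT xv => /sx ->.
Qed.

Lemma is_point_adj x v w : is_point X x -> x v != 0 -> x w != 0 -> v != w ->
  adj X v w.
Proof.
case=> s Xs [_ sx _] xv xw; apply: (simplex_adj Xs).
  by apply: contraNT xv => /sx ->.
by apply: contraNT xw => /sx ->.
Qed.

Lemma flag_is_point W x : flag X -> (forall v, 0 <= x v) -> supported W x ->
  \sum_(v <- W) x v = 1 -> (forall v, x v != 0 -> vertex X v) ->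
  (forall v w, x v != 0 -> x w != 0 -> v != w -> adj X v w) -> is_point X x.
Proof.
move=> fX x0 sW x1 xX xadj; have sF := supported_fsupp sW.
exists (fsupp x); last first.
  by split=> //; rewrite -x1; exact: sum_supported.
apply: fX => [|v|v w]; rewrite ?(in_fsupp _ sW); [|exact: xX|exact: xadj].
apply/negP => /eqP E; move/eqP: x1; rewrite (sum_supported sW sF) E big_seq_fset0.
by rewrite eq_sym oner_eq0.
Qed.

Lemma is_point_fsupp x : is_point X x ->
  simplex X (fsupp x) /\ std_simplex (fsupp x) x.
Proof.
move=> px; have [W sW XW] := is_point_supported px.
have sF := supported_fsupp sW; have x1 := is_point_sum px sF.
split; last by split=> // v; exact: is_point_ge0.
apply: simplex_sub XW _ _.
  apply/fsubsetP => v; rewrite (in_fsupp _ sW).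
  by apply: contraNT => /sW ->.
apply/negP => /eqP E; move/eqP: x1; rewrite E big_seq_fset0.
by rewrite eq_sym oner_eq0.
Qed.

End Points.

Section Collapse.
Variables (R : realType) (V : choiceType) (X : complex V) (v0 : V).
Implicit Types (x : V -> R) (W s : {fset V}).
Local Notation lev := (dist X v0).

(** A choice of common lower neighbour; the default value [v0] is taken only for sets
without one, which never arise as superlevel sets of a point of the complex. *)
Definition apex (k : nat) s : V :=
  xget v0 [set u | [/\ vertex X u, (lev u <= k)%N &
                       forall w, w \in s -> adj X u w]].

Definition shell (k : nat) W : {fset V} := [fset w in W | lev w == k.+1].

Definition apex_mass (k : nat) (u : V) s : R :=
  if u == apex k s then #|` s|%:R else 0.

(** The level [c] may be any real number: negative ones count as 0, so that [collapse]
does not move points with nonnegative weights for [c <= 0]. *)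
Definition collapse (k : nat) x (c : R) : V -> R := fun u =>
  (if (lev u <= k)%N then x u else Num.max 0 (x u - Num.max 0 c)) +
  layer_int (apex_mass k u) x (shell k (fsupp x)) fset0 0 (Num.max 0 c).

Lemma apex_mass_ge0 k u s : 0 <= apex_mass k u s.
Proof. by rewrite /apex_mass; case: ifP. Qed.

Lemma apex_mass_le k u s : `|apex_mass k u s| <= #|` s|%:R.
Proof. by rewrite /apex_mass; case: ifP; rewrite ?normr_nat ?normr0. Qed.

Lemma in_shell k W w : (w \in shell k W) = (w \in W) && (lev w == k.+1).
Proof. by rewrite !inE. Qed.

(** The support of [x] in the definition of [collapse] may be replaced by any finite set
containing it; this is what makes different points comparable. *)
Lemma collapseE k x c W u : supported W x ->
  collapse k x c u =
  (if (lev u <= k)%N then x u else Num.max 0 (x u - Num.max 0 c)) +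
  layer_int (apex_mass k u) x (shell k W) fset0 0 (Num.max 0 c).
Proof.
move=> sW; congr (_ + _); apply/esym; apply: layer_int_widen; rewrite ?fset_uniq//.
  move=> w; rewrite !in_shell (in_fsupp _ sW) => /andP[xw ->]; rewrite andbT.
  by apply: contraNT xw => /sW ->.
move=> w; rewrite !in_shell (in_fsupp _ sW) => /andP[_ ->].
by rewrite andbT negbK => /eqP ->.
Qed.


Lemma collapse_neq0 k x c W u : supported W x -> collapse k x c u != 0 ->
  [\/ x u != 0 /\ (lev u <= k)%N,
     Num.max 0 c < x u |
     exists r s, [/\ 0 <= r, r < Num.max 0 c, u = apex k s, s != fset0 &
       forall w, (w \in s) = (lev w == k.+1) && (r < x w)]].
Proof.
move=> sW; rewrite (collapseE _ _ _ sW).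
have [L0|/layer_int_neq0[r [s [r0 rc ms sP]]] _] :=
    eqVneq (layer_int (apex_mass k u) x (shell k W) fset0 0 (Num.max 0 c)) 0.
  rewrite L0 addr0; case: ifP => [lu xu|_ ]; first by constructor 1.
  case: (ltP 0 (x u - Num.max 0 c)) => [|_]; last by rewrite eqxx.
  by rewrite subr_gt0; constructor 2.
constructor 3; exists r, s; move: ms; rewrite /apex_mass.
have [-> s0|_] := eqVneq u _; last by rewrite eqxx.
split=> //; first by move: s0; rewrite pnatr_eq0 cardfs_eq0.
move=> w; rewrite sP in_fset0 in_shell /=.
have [//|wW] := boolP (w \in W).
by rewrite (sW _ wW) ltNge r0 !andbF.
Qed.

(** Superlevel sets of a point supported on [W] are subsets of [W], so all its
collapses are supported on [W] and the apexes of these subsets. *)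
Definition collapse_supp k W := W `|` [fset apex k s | s in fpowerset W].

Lemma collapse_supported k x c W : supported W x ->
  supported (collapse_supp k W) (collapse k x c).
Proof.
move=> sW u; apply: contraNeq => cu; rewrite in_fsetU.
have inW w : x w != 0 -> w \in W by apply: contraNT => /sW ->.
case: (collapse_neq0 sW cu) => [[/inW -> //]|cx|[r [s [r0 rc -> _ sP]]]].
  rewrite inW// gt_eqF// (le_lt_trans _ cx)// le_max lexx //.
apply/orP; right; apply/imfsetP; exists s => //=.
rewrite fpowersetE; apply/fsubsetP => w; rewrite sP => /andP[_ rx].
by rewrite inW// gt_eqF// (le_lt_trans r0).
Qed.

Lemma collapse_ge0 k x c u : (forall v, 0 <= x v) -> 0 <= collapse k x c u.
Proof.
move=> x0; apply: addr_ge0; first by case: ifP; rewrite // le_max lexx.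
by apply: layer_int_ge0 => t; exact: apex_mass_ge0.
Qed.

(** The mass that [layer_int] deposits at the apexes is what truncation at level [c]
removes from the outer sphere, so the total is preserved. *)
Lemma collapse_sum k x c W : (forall v, 0 <= x v) -> supported W x ->
  (forall v, x v != 0 -> (lev v <= k.+1)%N) ->
  \sum_(u <- collapse_supp k W) collapse k x c u = \sum_(v <- W) x v.
Proof.
move=> x0 sW xk; set c' := Num.max 0 c.
have c0 : 0 <= c' by rewrite le_max lexx.
pose A u := if (lev u <= k)%N then x u else Num.max 0 (x u - c').
pose B w := if lev w == k.+1 then Num.max 0 (Num.min c' (x w)) else 0.
under eq_bigr => u _ do rewrite (collapseE _ _ _ sW).
rewrite big_split layer_int_sum /=.
rewrite (@layer_int_ext _ _ _ (fun t => #|` t|%:R)); last first.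
  move=> t tW; have ta : apex k t \in collapse_supp k W.
    rewrite in_fsetU; apply/orP; right; apply/imfsetP; exists t => //=.
    rewrite fpowersetE; apply/fsubsetP => w /tW.
    by rewrite mem_cat in_fset0 /= in_shell => /andP[].
  rewrite (big_fsetD1 _ ta)/= big_seq big1 ?addr0.
    by rewrite /apex_mass eqxx.
  move=> u; rewrite in_fsetD1 => /andP[ua _].
  by rewrite /apex_mass (negbTE ua).
rewrite layer_int_card ?fset_uniq// cardfs0 mul0r add0r.
have -> : \sum_(w <- shell k W) Num.max 0 (Num.min c' (x w) - 0) = \sum_(w <- W) B w.
  rewrite -(@big_fset_incl _ _ _ _ (shell k W) W B).
  - by apply: eq_big_seq => w; rewrite in_shell /B => /andP[_ ->]; rewrite subr0.
  - by apply/fsubsetP => w; rewrite in_shell => /andP[].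
  - by move=> w wW; rewrite in_shell wW /= /B => /negbTE ->.
rewrite -/c' -(@big_fset_incl _ _ _ _ W (collapse_supp k W) A) ?fsubsetUl//; last first.
  move=> u _ uW; rewrite /A (sW _ uW); case: ifP => // _.
  by rewrite max_l// sub0r oppr_le0.
rewrite -big_split; apply: eq_bigr => w _ /=; rewrite /A /B.
have [lk|kl] := leqP (lev w) k; first by rewrite ltn_eqF ?addr0.
case: eqP => [_|/eqP lk].
  by have := x0 w; case: (leP c' (x w)) => ?; do ![case: leP => ?]; lra.
have -> : x w = 0.
  apply/eqP/negPn/negP => /xk; rewrite leq_eqVlt (negbTE lk) /= ltnS.
  by rewrite leqNgt kl.
by rewrite addr0 max_l// sub0r oppr_le0.
Qed.

Lemma collapse_id k x c W : supported W x ->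
  (forall v, x v != 0 -> (lev v <= k)%N) -> collapse k x c = x.
Proof.
move=> sW xk; apply/funext => u; rewrite (collapseE _ _ _ (supported_fsupp sW)).
have -> : shell k (fsupp x) = fset0.
  apply/fsetP => w; rewrite in_shell (in_fsupp _ sW) in_fset0.
  by apply/negbTE/negP => /andP[/xk wk /eqP wk1]; rewrite wk1 ltnn in wk.
rewrite /= /apex_mass cardfs0 if_same mulr0 addr0; case: ifPn => // uk.
have -> : x u = 0 by apply/eqP; apply: contraNT uk; exact: xk.
by rewrite max_l// sub0r oppr_le0 le_max lexx.
Qed.

Lemma collapse_le0 k x c : (forall v, 0 <= x v) -> c <= 0 -> collapse k x c = x.
Proof.
move=> x0 c0; apply/funext => u; rewrite /collapse (max_l c0).
by rewrite layer_int_empty// addr0 subr0 max_r// if_same.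
Qed.

Lemma apexP k s : connected_complex X -> weakly_systolic X -> vertex X v0 ->
  simplex X s -> (forall w, w \in s -> lev w = k.+1) ->
  [/\ vertex X (apex k s), (lev (apex k s) <= k)%N &
      forall w, w \in s -> adj X (apex k s) w].
Proof.
move=> Xc Xw Xv0 Xs /(lower_common_nbr Xc Xw Xv0 Xs) ex.
exact: (@xgetPex _ v0 [set u | [/\ vertex X u, (lev u <= k)%N &
  forall w, w \in s -> adj X u w]]%classic ex).
Qed.

(** Every vertex carrying mass after the collapse is one of three kinds: a vertex of
the smaller ball, a vertex [w] of the outer sphere with [c < x w], or the apex of
the superlevel set at some level [r < c]. Vertices of the
first two kinds lie in the simplex carrying [x]. As superlevel sets decrease with
the level, an apex and a vertex of the first or third kind are both adjacent to
some vertex of the sphere, hence equal or adjacent. A vertex of the second kind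
belongs to all superlevel sets below [c], so it is adjacent to their apexes. *)
Lemma collapse_point k x c :
  connected_complex X -> weakly_systolic X -> vertex X v0 ->
  is_point X x -> (forall v, x v != 0 -> (lev v <= k.+1)%N) ->
  is_point X (collapse k x c).
Proof.
move=> Xc Xw Xv0 px xk; have x0 v := is_point_ge0 v px.
have [W sW XW] := is_point_supported px.
set c' := Num.max 0 c; have c0 : 0 <= c' by rewrite le_max lexx.
have pos r w : 0 <= r -> r < x w -> x w != 0.
  by move=> r0 rx; rewrite gt_eqF// (le_lt_trans r0).
(* superlevel sets are faces of the simplex carrying [x], so their apexes exist *)
have sup r s : 0 <= r -> s != fset0 ->
    (forall w, (w \in s) = (lev w == k.+1) && (r < x w)) ->
    [/\ vertex X (apex k s), (lev (apex k s) <= k)%N &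
        forall w, w \in s -> adj X (apex k s) w].
  move=> r0 sn0 sP; apply: apexP => //; last first.
    by move=> w; rewrite sP => /andP[/eqP].
  apply: simplex_sub XW _ sn0; apply/fsubsetP => w; rewrite sP => /andP[_ rx].
  by move: (pos _ _ r0 rx); apply: contraNT => /sW ->.
have xadj v w := @is_point_adj _ _ _ _ v w px.
have ball_apex r s v : 0 <= r -> s != fset0 ->
    (forall w, (w \in s) = (lev w == k.+1) && (r < x w)) ->
    x v != 0 -> (lev v <= k)%N -> v != apex k s -> adj X v (apex k s).
  move=> r0 sn0 sP xv lv va; have [Xa la aP] := sup _ _ r0 sn0 sP.
  have /fset0Pn[w ws] := sn0.
  have /andP[/eqP lw rw] : (lev w == k.+1) && (r < x w) by rewrite -sP.
  have vw : adj X v w.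
    apply: xadj => //; first exact: pos rw.
    by apply: contraTneq lv => ->; rewrite lw ltnn.
  case: (lower_nbrs_adj Xc Xw Xv0 lw vw (aP _ ws) lv la) => // E.
  by rewrite E eqxx in va.
have sphere_apex r s v : 0 <= r -> r < c' -> s != fset0 ->
    (forall w, (w \in s) = (lev w == k.+1) && (r < x w)) ->
    c' < x v -> v != apex k s -> adj X v (apex k s).
  move=> r0 rc sn0 sP cv va; have xv := pos _ _ c0 cv.
  have [lv|lv] := leqP (lev v) k; first exact: (ball_apex r).
  have [_ _ aP] := sup _ _ r0 sn0 sP; apply/adj_sym/aP; rewrite sP (lt_trans rc)//.
  by rewrite eqn_leq lv xk.
have apex_apex r s r' s' : 0 <= r -> r <= r' -> s != fset0 -> s' != fset0 ->
    (forall w, (w \in s) = (lev w == k.+1) && (r < x w)) ->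
    (forall w, (w \in s') = (lev w == k.+1) && (r' < x w)) ->
    apex k s != apex k s' -> adj X (apex k s) (apex k s').
  move=> r0 rr sn0 sn0' sP sP' aa.
  have [Xa la aP] := sup _ _ r0 sn0 sP.
  have [Xa' la' aP'] := sup _ _ (le_trans r0 rr) sn0' sP'.
  have /fset0Pn[w ws'] := sn0'; move: (ws'); rewrite sP' => /andP[lw rw].
  have ws : w \in s by rewrite sP lw (le_lt_trans rr).
  case: (lower_nbrs_adj Xc Xw Xv0 (eqP lw) (aP _ ws) (aP' _ ws') la la') => // E.
  by rewrite E eqxx in aa.
apply: (@flag_is_point _ _ _ (collapse_supp k W)).
- exact: Xw.1.
- by move=> v; exact: collapse_ge0.
- exact: collapse_supported.
- by rewrite collapse_sum// (is_point_sum px).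
- move=> v /(collapse_neq0 sW)[[xv _]|cx|[r [s [r0 rc -> sn0 sP]]]].
  + exact: is_point_vertex px xv.
  + exact: (is_point_vertex px (pos _ _ c0 cx)).
  + by have [] := sup _ _ r0 sn0 sP.
move=> v w /(collapse_neq0 sW)[[xv lv]|cv|[r [s [r0 rc -> sn0 sP]]]];
  move=> /(collapse_neq0 sW)[[xw lw]|cw|[r' [s' [r0' rc' -> sn0' sP']]]] vw.
- exact: xadj.
- by apply: xadj => //; exact: pos cw.
- exact: (ball_apex r').
- by apply: xadj => //; exact: pos cv.
- by apply: xadj => //; [exact: pos cv|exact: pos cw].
- exact: (sphere_apex r').
- by apply/adj_sym/(ball_apex r) => //; rewrite eq_sym.
- by apply/adj_sym/(sphere_apex r) => //; rewrite eq_sym.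
- have [rr|/ltW rr] := leP r r'; first exact: (apex_apex r _ r').
  by apply/adj_sym/(apex_apex r' _ r) => //; rewrite eq_sym.
Qed.

Lemma collapse_level k x c u :
  connected_complex X -> weakly_systolic X -> vertex X v0 ->
  is_point X x -> 1 <= c -> collapse k x c u != 0 -> (lev u <= k)%N.
Proof.
move=> Xc Xw Xv0 px c1; have [W sW XW] := is_point_supported px.
case/(collapse_neq0 sW) => [[] //||[r [s [r0 _ -> sn0 sP]]]].
  by rewrite ltNge (le_trans (is_point_le1 u px))// le_max c1 orbT.
case: (@apexP k s) => //; last by move=> w; rewrite sP => /andP[/eqP].
apply: simplex_sub XW _ sn0; apply/fsubsetP => w; rewrite sP => /andP[_].
by apply: contraTT => /sW ->; rewrite -leNgt.
Qed.

Lemma collapse_lip k W : exists2 L : R, 0 <= L & forall x y c c' (d : R) u,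
  supported W x -> supported W y -> (forall v, `|x v - y v| <= d) ->
  `|c - c'| <= d -> `|collapse k x c u - collapse k y c' u| <= L * d.
Proof.
have [L L0 HL] :=
  @layer_int_lip R V (fun s => #|` s|%:R) (shell k W) fset0 (fun=> ler0n _ _).
exists (2 + L); first by rewrite addr_ge0.
move=> x y c c' d u sx sy xy cc; have d0 : 0 <= d := le_trans (normr_ge0 _) cc.
have z0 : `|0 - 0 : R| <= d by rewrite subrr normr0.
have cc0 : `|Num.max 0 c - Num.max 0 c'| <= d by exact: dist_max.
rewrite (collapseE _ _ _ sx) (collapseE _ _ _ sy) opprD addrACA.
rewrite (le_trans (ler_normD _ _))// mulrDl lerD//; last first.
  by apply: HL => // t; exact: apex_mass_le.
case: ifP => _; first by rewrite (le_trans (xy u))//; lra.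
apply: dist_max; first by rewrite (le_trans z0)//; lra.
by move: (xy u) cc0; rewrite !ler_norml; lra.
Qed.

End Collapse.

(** * Collapsing all spheres in turn *)

(** The Lipschitz condition is imposed over each finite set of vertices separately,
with bounds for the coordinates and the time that are uniform over that set.
Unlike continuity for the weak topology, it makes sense for maps between raw
coordinate functions and is stable under composition. *)
Definition fin_lipschitz (R : realType) (V : choiceType)
    (F : (V -> R) -> R -> V -> R) : Prop :=
  forall W, exists (W' : {fset V}) (L : R), 0 <= L /\
    forall x t, supported W x -> supported W' (F x t) /\
      forall y t' (d : R) u, supported W y -> (forall v, `|x v - y v| <= d) ->
        `|t - t'| <= d -> `|F x t u - F y t' u| <= L * d.

Section Deform.
Variables (R : realType) (V : choiceType) (X : complex V) (v0 : V).
Implicit Types (x : V -> R) (W : {fset V}).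
Local Notation lev := (dist X v0).

(** The [k]-th collapse takes place while [2 ^ k.+1 * t] runs from 1 to 2, the
outer spheres first. *)
Fixpoint deform (n : nat) x (t : R) : V -> R :=
  if n is k.+1 then deform k (collapse X v0 k x (2 ^+ k.+1 * t - 1)) t else x.

Lemma deform_early n x t : (forall v, 0 <= x v) -> 2 ^+ n * t <= 1 ->
  deform n x t = x.
Proof.
elim: n => [//|n IH] x0 nt /=; rewrite collapse_le0 ?subr_le0// IH//.
have [t0|/ltW t0] := leP t 0.
  by rewrite (le_trans (mulr_ge0_le0 _ t0)) ?exprn_ge0.
by apply: le_trans nt; rewrite ler_wpM2r// ler_eXn2l// ltr1n.
Qed.

(** When the next collapse is incomplete, that is [2 ^ n * t < 1], the remaining ones
have not begun. *)
Lemma deform_point n x t :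
  connected_complex X -> weakly_systolic X -> vertex X v0 ->
  is_point X x -> (forall v, x v != 0 -> (lev v <= n)%N) ->
  is_point X (deform n x t).
Proof.
move=> Xc Xw Xv0; elim: n x => [//|n IH] x px xn /=.
set c := _ - 1; have py : is_point X (collapse X v0 n x c) by exact: collapse_point.
have [c1|c1] := leP 1 c; first by apply: IH => // v; exact: collapse_level.
rewrite deform_early//; first by move=> v; exact: is_point_ge0 py.
by move: c1; rewrite /c exprS; lra.
Qed.

Lemma deform_end n x v :
  connected_complex X -> weakly_systolic X -> vertex X v0 ->
  is_point X x -> (forall v, x v != 0 -> (lev v <= n)%N) ->
  deform n x 1 v != 0 -> v = v0.
Proof.
move=> Xc Xw Xv0; elim: n x => [|n IH] x px xn /=.
  move=> xv; have [m vm] := Xc _ _ Xv0 (is_point_vertex px xv).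
  by have [+ _] := dist_walk vm; have := xn v xv; case: (lev v) => // _ /walk0.
apply: IH; first exact: collapse_point.
move=> w; apply: collapse_level => //.
have : 1 <= 2 ^+ n :> R by rewrite exprn_ege1// ler1n.
by rewrite exprS; lra.
Qed.

Lemma deform_stable n m x t W : supported W x ->
  (forall v, x v != 0 -> (lev v <= n)%N) -> (n <= m)%N ->
  deform m x t = deform n x t.
Proof.
move=> sW xn /subnK <-; elim: (m - n)%N => [//|k IH].
rewrite addSn /= (collapse_id _ sW)// => v /xn /leq_trans -> //.
exact: leq_addl.
Qed.

Lemma deform_lip n : @fin_lipschitz R V (deform n).
Proof.
elim: n => [|n IH] W.
  by exists W, 1; split=> // x t sx; split=> // y t' d u _ xy _; rewrite mul1r.
have [W' [L [L0 HL]]] := IH (collapse_supp X v0 n W).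
have [K K0 HK] := @collapse_lip R V X v0 n W.
have e1 : 1 <= 2 ^+ n.+1 :> R by rewrite exprn_ege1// ler1n.
exists W', (L * (1 + K * 2 ^+ n.+1)); split.
  by rewrite mulr_ge0// addr_ge0// mulr_ge0// (le_trans _ e1).
move=> x t sx /=.
have [? lip] :=
  HL _ t (@collapse_supported R V X v0 n x (2 ^+ n.+1 * t - 1) W sx).
split=> // y t' d u sy xy tt; have d0 : 0 <= d := le_trans (normr_ge0 _) tt.
rewrite -mulrA; apply: lip; first exact: collapse_supported.
- move=> v; rewrite (le_trans (HK _ _ _ _ (2 ^+ n.+1 * d) _ sx sy _ _))//.
  + by move=> w; rewrite (le_trans (xy w))// ler_peMl.
  + rewrite opprB addrA subrK -mulrBr normrM ger0_norm ?ler_wpM2l//; lra.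
  + by rewrite mulrA mulrDl mul1r lerDr.
- by rewrite (le_trans tt)// mulrDl mul1r lerDl !mulr_ge0// (le_trans _ e1).
Qed.

End Deform.

(** * Continuity in the weak topology *)

Section Continuity.
Variables (R : realType) (V : choiceType) (X : complex V).

(** The weak topology gives a radius on each of the finitely many simplices with
vertices in [W] that contain [y]; a simplex missing [y] misses a vertex in the
support of [y], and its points stay away from [y] in that coordinate. *)
Lemma open_finite (U : set (realization R X)) (y : realization R X)
    (W : {fset V}) : open U -> U y ->
  exists2 e : R, 0 < e & forall z : realization R X, supported W z ->
    (forall v, `|y v - z v| < e) -> U z.
Proof.
move=> oU Uy.
have one s : exists2 e : R, 0 < e & forall z : realization R X, simplex X s ->
    std_simplex s z -> (forall v, `|y v - z v| < e) -> U z.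
  have [sy|/existsNP[v /not_implyP[vs /eqP yv]]] := pselect (supported s y); last first.
    exists `|y v|; first by rewrite normr_gt0.
    by move=> z _ [_ zs _] /(_ v); rewrite zs// subr0 ltxx.
  have [Xs|nXs] := pselect (simplex X s); last by exists 1.
  have [|e e0 eU] := oU s Xs y _ Uy.
    split=> //; last exact: is_point_sum (coordP y) sy.
    by move=> v; exact: is_point_ge0 (coordP y).
  by exists e => // z _ sz yz; apply: eU.
have all (S : seq {fset V}) : exists2 e : R, 0 < e &
    forall s (z : realization R X), s \in S -> simplex X s ->
    std_simplex s z -> (forall v, `|y v - z v| < e) -> U z.
  elim: S => [|s S [e e0 eU]]; first by exists 1.
  have [f f0 fU] := one s; exists (Num.min e f); first by rewrite lt_min e0.
  move=> s' z; rewrite inE => /orP[/eqP ->|s'S] Xs sz yz.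
    by apply: fU => // v; move: (yz v); rewrite lt_min => /andP[].
  by apply: (eU s') => // v; move: (yz v); rewrite lt_min => /andP[].
have [e e0 eU] := all (fpowerset W); exists e => // z zW.
have [Xz sz] := is_point_fsupp (coordP z); apply: (eU (fsupp z)) => //.
rewrite fpowersetE; apply/fsubsetP => v; rewrite (in_fsupp _ zW).
by apply: contraNT => /zW ->.
Qed.

(** For [U] open and a compact interval [J], the set of the [x] with [U (F x t)] for all
[t] in [J] is open: this is the tube lemma on each simplex, and the weak topology
asks for no more. *)
Lemma fin_lipschitz_continuous (F : (V -> R) -> R -> V -> R)
    (FX : forall (x : realization R X) t, is_point X (F x t)) :
  fin_lipschitz F ->
  continuous (fun p : realization R X * R => Realization (FX p.1 p.2)).
Proof.
move=> FL; pose G x t := Realization (FX x t).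
have near_pt (U : set (realization R X)) s (x : realization R X) t :
    open U -> supported s x -> U (G x t) ->
    exists2 e : R, 0 < e & forall (y : realization R X) t', supported s y ->
      (forall v, `|x v - y v| <= e) -> `|t - t'| <= e -> U (G y t').
  move=> oU sx Ux; have [W [L [L0 FW]]] := FL s.
  have [e e0 eU] := open_finite W oU Ux.
  have L1 : 0 < L + 1 by rewrite ltr_wpDl.
  (* [L + 1] rather than [L], to divide by a nonzero number and keep [<] *)
  exists (e / (L + 1)); first by rewrite divr_gt0.
  move=> y t' sy xy tt; have [_ /(_ y t' _ _ sy xy tt) lip] := FW _ t sx.
  apply: eU; first by have [] := FW _ t' sy.
  move=> v; apply: le_lt_trans (lip v) _.
  by rewrite mulrCA gtr_pMr// ltr_pdivrMr// mul1r ltrDl.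
move=> [x0 t0] A /=; rewrite nbhsE => -[U [oU Ux0] UA].
have [s0 Xs0 [_ sx0 _]] := coordP x0.
have [e e0 eU] := near_pt U s0 x0 t0 oU sx0 Ux0.
pose J := `[t0 - e, t0 + e]%classic.
have inJ t : J t <-> `|t0 - t| <= e.
  rewrite /J /= in_itv /= ler_norml; split=> [/andP[]|/andP[]] *; apply/andP; split; lra.
pose O : set (realization R X) := [set x | forall t, J t -> U (G x t)].
have oO : open O.
  move=> s Xs x sx Ox.
  have /compact_near_coveringP Jc : compact J by exact: segment_compact.
  have cov : forall t, J t -> \forall t' \near t & d \near 0^'+,
      forall y : realization R X, std_simplex s y ->
      (forall v, v \in s -> `|x v - y v| < d) -> U (G y t').
    move=> t Jt; have [_ xs _] := sx.
    have [d d0 dU] := near_pt U s x t oU xs (Ox _ Jt).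
    exists ([set t' | `|t - t'| <= d], [set d' | d' <= d]) => /=.
      split; last exact: nbhs_right_le.
      by apply/nbhs_ballP; exists d => //= t'; rewrite /ball /= => /ltW.
    move=> [t' d'] [/= tt dd] y [y0 ys y1] xy; apply: dU => // v.
    have [vs|vs] := boolP (v \in s); first by rewrite (le_trans (ltW (xy _ vs))).
    by rewrite xs// ys// subrr normr0 ltW.
  have {}cov := Jc _ _ _ (at_right_proper_filter 0) cov.
  have [d [dU d0]] := filter_ex (filterI cov (nbhs_right_gt 0)).
  by exists d => // y sy xy t Jt; exact: dU.
exists (O, J) => /=.
  split; last first.
    by apply/nbhs_ballP; exists e => //= t; rewrite /ball /= => /ltW te; apply/inJ.
  apply: open_nbhs_nbhs; split=> // t /inJ te; apply: eU => // v.
  by rewrite subrr normr0 ltW.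
by move=> [x t] [/= Ox Jt]; apply: UA; exact: Ox.
Qed.

Lemma realization_eq (x y : realization R X) : (x : V -> R) = y -> x = y.
Proof.
case: x y => [x px] [y py] /= E; rewrite E in px *.
by rewrite (Prop_irrelevance px py).
Qed.

End Continuity.

Theorem theoremA (R : realType) (V : choiceType) (X : complex V) :
  nonempty_complex X -> connected_complex X ->
  finite_dimensional X -> weakly_systolic X ->
  contractible R (realization R X).
Proof.
move=> [v0 Xv0] Xc _ Xw.
pose height (W : {fset V}) := (\max_(v <- W) dist X v0 v)%N.
have heightP (W : {fset V}) v : v \in W -> (dist X v0 v <= height W)%N.
  by move=> vW; rewrite /height (big_fsetD1 _ vW) leq_maxl.
pose F (x : V -> R) t := deform X v0 (height (fsupp x)) x t.
(* any radius containing the support gives the same map, so a single one may be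
   used for all points over a given finite set of vertices *)
have FE W x t : supported W x -> F x t = deform X v0 (height W) x t.
  move=> sW; have sF := supported_fsupp sW.
  rewrite /F; apply/esym/(deform_stable t sF).
    by move=> v xv; apply: heightP; rewrite (in_fsupp _ sW).
  apply/bigmax_leqP_seq => v; rewrite (in_fsupp _ sW) => xv _; apply: heightP.
  by apply: contraNT xv => /sW ->.
have level (x : realization R X) v : x v != 0 -> (dist X v0 v <= height (fsupp x))%N.
  have [W sW _] := is_point_supported (coordP x).
  by move=> xv; apply: heightP; rewrite (in_fsupp _ sW).
have FX (x : realization R X) t : is_point X (F x t).
  by apply: deform_point => //; [exact: coordP|exact: level].
have FL : fin_lipschitz F.
  move=> W; have [W' [L [L0 FW]]] := @deform_lip R V X v0 (height W) W.
  exists W', L; split=> // x t sx; rewrite (FE _ _ _ sx); have [? lip] := FW x t sx.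
  by split=> // y t' d u sy; rewrite (FE _ _ _ sy); exact: lip.
have at_base (y : V -> R) : is_point X y -> (forall v, y v != 0 -> v = v0) ->
    y = fun v => (v == v0)%:R.
  move=> py yv0; have sy : supported [fset v0] y.
    by move=> v; rewrite in_fset1; apply: contraNeq => /yv0 ->.
  apply/funext => v; have [->|] := eqVneq v v0.
    by rewrite -[RHS](is_point_sum py sy) big_seq_fset1.
  by rewrite -in_fset1 => /sy.
have P0 : is_point X (fun v => (v == v0)%:R : R).
  exists [fset v0] => //; split=> [v|v|]; first exact: ler0n.
    by rewrite in_fset1 => /negbTE ->.
  by rewrite big_seq_fset1 eqxx.
exists (Realization P0), (fun p => Realization (FX p.1 p.2)); split.
- exact/continuous_subspaceT/fin_lipschitz_continuous.
- move=> x; apply: realization_eq; apply: deform_early; last by rewrite mulr0.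
  by move=> v; exact: is_point_ge0 (coordP x).
- move=> x; apply/realization_eq/at_base; first exact: FX.
  by move=> v; apply: deform_end => //; [exact: coordP|exact: level].
Qed.
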